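(* For every $n \in \mathbb{N}$ and every $d \in \mathbb{Q}$ with $d > 1$, there exists a graph $G$ with $$ e(G) \le C\, n^{2 - 1/(\lceil d \rceil + 1)} $$ edges which is $\mathcal{H}_d(n)$-universal, where $C = C(d)$ is a constant depending only on $d$.
   Context: All graphs are finite and simple. For a graph $H$, its density is $m(H) = \max_{H' \subseteq H} e(H')/v(H')$, where $e(\cdot)$ and $v(\cdot)$ denote numbers of edges and vertices. For $d \in \mathbb{Q}$ and $n \in \mathbb{N}$, $\mathcal{H}_d(n)$ is the family of all graphs on $n$ vertices with density at most $d$. A graph $G$ is universal for a family $\mathcal{H}$ (or $\mathcal{H}$-universal) if every $H \in \mathcal{H}$ is a (not necessarily induced) subgraph of $G$. *)

(* Defs.v *)
From mathcomp Require Import all_boot all_order all_algebra.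

Set Implicit Arguments.
Unset Strict Implicit.
Unset Printing Implicit Defensive.

Import Order.TTheory GRing.Theory Num.Theory.
Local Open Scope ring_scope.

Record sgraph := SGraph {
  vertex :> finType;
  adj : rel vertex;
  adj_sym : symmetric adj;
  adj_irrefl : irreflexive adj
}.

Definition edges (G : sgraph) : {set {set G}} :=
  [set [set p.1; p.2] | p : G * G & adj p.1 p.2].

(* A subgraph (not necessarily induced) is encoded as the pair of its vertex
   set and its edge set. *)
Definition is_subgraph (G : sgraph) (S : {set G} * {set {set G}}) : bool :=
  (S.2 \subset edges G) && [forall e in S.2, e \subset S.1].

(* The default value 0 matters only for the graph without vertices: otherwise
   a one-vertex subgraph already contributes 0. *)
Definition density (G : sgraph) : rat :=
  \big[Num.max/0]_(S : {set G} * {set {set G}}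
                     | is_subgraph S && (S.1 != set0))
     (#|S.2|%:R / #|S.1|%:R).

Definition embeds (H G : sgraph) : Prop :=
  exists2 f : H -> G, injective f & forall x y, adj x y -> adj (f x) (f y).

Definition density_family (d : rat) (n : nat) (H : sgraph) : Prop :=
  #|H| = n /\ density H <= d.

Definition universal (F : sgraph -> Prop) (G : sgraph) : Prop :=
  forall H : sgraph, F H -> embeds H G.

(* Main.v *)
(* Let k be the ceiling of d and q = 2^m with q^(k+1) of order n. By Hall's theorem a graph H
   of density at most k has an orientation with out-degrees at most k. The O(n/q) vertices
   of in-degree larger than about q are mapped to hubs, joined to everything.

   Every other vertex w gets a label z_w out of about q labels, and z_w determines a set
   S(z_w) of colours in [q]; w is mapped to the slot (z_w, x_1, ..., x_k), where x_i is a
   colour of S(z_u) for the i-th out-neighbour u of w. Joining (z, x) to (z', x') whenever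
   some x_i lies in S(z') or conversely gives about n^2/q edges, and any such map is a
   homomorphism; it remains to put only boundedly many vertices in each slot. Labels and
   colours are chosen greedily, vertex by vertex, avoiding the values that would overload a
   slot with some coordinates prescribed; such values are a small proportion of all. A vertex
   u of in-degree D must be given a label that works for its D in-neighbours at once. This is
   possible when the S(z) are random sets of size t with 2^t >= D and there are at least
   qD/t labels. Vertices of in-degree about D number O(n/D), so for large D the extra labels
   and colours are paid for by reading the coordinates x_i of such vertices more coarsely. *)
Require Import Defs.
From mathcomp Require Import all_boot all_order all_algebra.
From mathcomp Require Import zify ring.

Set Implicit Arguments.
Unset Strict Implicit.
Unset Printing Implicit Defensive.

Import Order.TTheory GRing.Theory Num.Theory.

(* Rado's proof of Hall's theorem: if a set [r e] has two elements and neither can be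
   deleted, two tight sets X and Y contradict submodularity of the neighbourhood size. *)
Lemma rado (E V : finType) (r : E -> {set V}) :
  (forall X : {set E}, #|X| <= #|\bigcup_(e in X) r e|) ->
  exists2 f : E -> V, injective f & forall e, f e \in r e.
Proof.
have [m le_m] := ubnP (\sum_e #|r e|).
elim: m => // m IHm in r le_m *; move=> hall.
have r_gt0 e : 0 < #|r e|.
  by have := hall [set e]; rewrite cards1 big_set1.
case: (boolP [forall e, #|r e| <= 1]) => [/forallP r_le1|].
  have r_ex e : exists x, r e == [set x].
    have/cards1P[x ->] : #|r e| == 1 by rewrite eqn_leq r_le1 r_gt0.
    by exists x.
  exists (fun e => xchoose (r_ex e)) => [e1 e2 eq12|e]; last first.
    by rewrite {2}(eqP (xchooseP (r_ex e))) set11.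
  apply/eqP/negP => /negP ne12; have := hall [set e1; e2].
  rewrite cards2 ne12 big_setU1 ?inE //= big_set1.
  by rewrite (eqP (xchooseP (r_ex e1))) (eqP (xchooseP (r_ex e2))) eq12 setUid cards1.
rewrite negb_forall => /existsP[e]; rewrite -ltnNge => /card_gt1P[a [b [ae be nab]]].
pose cut x e' := if e' == e then r e :\ x else r e'.
have cut_sub x e' : cut x e' \subset r e'.
  by rewrite /cut; case: eqP => // ->; rewrite subD1set.
have cut_dec x : x \in r e ->
  (forall X : {set E}, #|X| <= #|\bigcup_(e in X) cut x e|) ->
  exists2 f : E -> V, injective f & forall e, f e \in r e.
  move=> xe /IHm[|f f_inj fP]; last by exists f => // e'; exact: (subsetP (cut_sub x e')).
  rewrite -ltnS; apply: leq_trans le_m; rewrite ltnS.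
  rewrite (bigD1 e) //= [X in _ < X](bigD1 e) //= /cut eqxx.
  rewrite (cardsD1 x (r e)) xe add1n addSn ltnS leq_add2l.
  by apply: leq_sum => e' /negbTE->.
pose viol x (X : {set E}) := #|\bigcup_(e in X) cut x e| < #|X|.
have cut_or x : x \in r e -> (exists2 f : E -> V, injective f & forall e, f e \in r e)
    \/ exists2 X : {set E}, e \notin X & #|(\bigcup_(e in X) r e) :|: (r e :\ x)| <= #|X|.
  move=> xe; case: (boolP [exists X, viol x X]) => [/existsP[X]|]; last first.
    rewrite negb_exists => /forallP cutP; left; apply: (cut_dec x xe) => X.
    by rewrite leqNgt; exact: cutP.
  rewrite /viol => vX; right.
  have cutE (Y : {set E}) : e \notin Y -> \bigcup_(e in Y) cut x e = \bigcup_(e in Y) r e.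
    move=> eY; apply: eq_bigr => e' e'Y; rewrite /cut ifN //.
    by apply: contraNneq eY => <-.
  have eX : e \in X.
    by apply: contraTT vX => eX; rewrite -leqNgt cutE.
  exists (X :\ e); first by rewrite setD11.
  move: vX; rewrite (big_setD1 e) //= cutE ?setD11 // /cut eqxx setUC.
  by rewrite (cardsD1 e X) eX add1n ltnS.
case: (cut_or a ae) => // -[X eX leX]; case: (cut_or b be) => // -[Y eY leY].
exfalso.
set NX := \bigcup_(_ in X) _ in leX; set NY := \bigcup_(_ in Y) _ in leY.
have := leq_add leX leY; rewrite leqNgt => /negP[].
rewrite -cardsUI -[X in _ < X]cardsUI -addSn; apply: leq_add.
  have := hall (e |: (X :|: Y)).
  rewrite cardsU1 !inE negb_or eX eY add1n => /leq_trans; apply.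
  apply: subset_leq_card; apply/bigcupsP => e'; rewrite !inE.
  case/or3P => [/eqP->|e'X|e'Y].
  - apply/subsetP => c ce; rewrite !inE ce !andbT.
    by case: (eqVneq c a) => [->|_]; rewrite /= ?nab !orbT.
  - by apply: subset_trans (bigcup_sup _ e'X) _; rewrite -setUA subsetUl.
  - by rewrite setUC -setUA; apply: subset_trans (bigcup_sup _ e'Y) _; rewrite subsetUl.
apply: leq_trans (hall (X :&: Y)) _; apply: subset_leq_card.
apply/bigcupsP => e'; rewrite inE => /andP[e'X e'Y].
by rewrite subsetI !subsetU //  bigcup_sup.
Qed.

Lemma card_bigcup_le (I T : finType) (P : pred I) (F : I -> {set T}) :
  #|\bigcup_(i | P i) F i| <= \sum_(i | P i) #|F i|.
Proof.
elim/big_rec2: _ => [|i m A _ le_Am]; first by rewrite cards0.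
by rewrite (leq_trans (leq_card_setU _ _)) ?leq_add2l.
Qed.

Lemma card_set (T : finType) : #|{: {set T}}| = 2 ^ #|T|.
Proof. by have := card_powerset [set: T]; rewrite powersetT !cardsT. Qed.

(* Union bound over A and the family Bs: a random family of t-element samples is bad for
   given A, Bs with probability at most (D * 64^-t)^|A| <= 32^(-t|A|). *)
Lemma sampler (q Z D t : nat) : 0 < q -> 0 < Z -> 0 < t -> D <= 2 ^ t -> q * D <= t * Z ->
  exists2 S : 'I_Z -> {set 'I_q}, forall z, #|S z| <= t &
    forall (A : {set 'I_Z}) (Bs : seq {set 'I_q}),
      Z <= 2 * #|A| -> size Bs <= D -> (forall B : {set 'I_q}, B \in Bs -> 64 * #|B| <= q) ->
      exists2 z, z \in A & all (fun B : {set 'I_q} => ~~ (S z \subset B)) Bs.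
Proof.
move=> q_gt0 Z_gt0 t_gt0 leD letZ.
pose TF := {ffun 'I_Z -> {ffun 'I_t -> 'I_q}}.
pose good (A : {set 'I_Z}) (B : {ffun 'I_D -> {set 'I_q}}) :=
  (Z <= 2 * #|A|) && [forall j, 64 * #|B j| <= q].
pose bad (B : {ffun 'I_D -> {set 'I_q}}) :=
  [set f : {ffun 'I_t -> 'I_q} | [exists j, [forall l, f l \in B j]]].
pose ev (A : {set 'I_Z}) B : {set TF} :=
  [set F : TF | [forall z in A, F z \in bad B]].
have card_bad A B : good A B -> 32 ^ t * #|bad B| <= q ^ t.
  case/andP=> _ /forallP leB; rewrite -(leq_pmul2l (_ : 0 < 2 ^ t)) ?expn_gt0 //.
  rewrite mulnA -expnMn.
  apply: (@leq_trans (\sum_(j < D) (64 * #|B j|) ^ t)).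
    have sub : bad B \subset \bigcup_(j < D) [set f : {ffun 'I_t -> 'I_q} | f \in ffun_on (B j)].
      apply/subsetP => f; rewrite inE => /existsP[j /forallP fB].
      by apply/bigcupP; exists j => //; rewrite inE; apply/ffun_onP.
    apply: leq_trans (leq_mul (leqnn _) (leq_trans (subset_leq_card sub) (card_bigcup_le _ _))) _.
    rewrite big_distrr /=; apply: leq_sum => j _.
    by rewrite cardsE card_ffun_on card_ord -expnMn.
  apply: (@leq_trans (\sum_(j < D) q ^ t)).
    by apply: leq_sum => j _; rewrite leq_exp2r.
  by rewrite sum_nat_const card_ord leq_mul2r leD orbT.
have card_ev A B : good A B -> 2 ^ (Z + q * D + 1) * #|ev A B| <= #|{: TF}|.
  move=> gAB; have /andP[leA _] := gAB.
  have -> : #|ev A B| = #|bad B| ^ #|A| * (q ^ t) ^ (Z - #|A|).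
    have -> : #|ev A B| = #|family (fun z => if z \in A then mem (bad B) else mem predT)|.
      apply: eq_card => F; rewrite inE.
      apply/forall_inP/familyP => FP z; first by case: ifP => // /FP.
      by move=> zA; have := FP z; rewrite zA.
    rewrite card_family foldrE big_map big_enum /= (bigID (mem A)) /=.
    rewrite (eq_bigr (fun=> #|bad B|)); last by move=> z ->.
    rewrite prod_nat_const; congr (_ * _).
    rewrite (eq_bigr (fun=> q ^ t)); last first.
      by move=> z /negbTE->; rewrite card_ffun !card_ord.
    rewrite prod_nat_const; congr (_ ^ _).
    by rewrite -[X in X - _](card_ord Z) -(cardsC A) addKn -[in RHS]cardsE;
      apply: eq_card => z; rewrite !inE.
  rewrite card_ffun card_ffun !card_ord.
  have leAZ : #|A| <= Z by rewrite -[X in _ <= X](card_ord Z) max_card.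
  have -> : (q ^ t) ^ Z = (q ^ t) ^ #|A| * (q ^ t) ^ (Z - #|A|).
    by rewrite -expnD subnKC.
  rewrite mulnA leq_mul2r; apply/orP; right.
  apply: (@leq_trans ((32 ^ t) ^ #|A| * #|bad B| ^ #|A|)); last first.
    by rewrite -expnMn; case: #|A| => [|a]; rewrite ?expn0 // leq_exp2r // (card_bad A B).
  rewrite leq_mul2r; apply/orP; right.
  rewrite (_ : 32 = 2 ^ 5) // -!expnM leq_exp2l //.
  have h1 : Z <= t * Z by rewrite leq_pmull.
  have h2 : t * Z <= t * (2 * #|A|) by rewrite leq_mul2l leA orbT.
  have h3 : 0 < t * Z by rewrite muln_gt0 t_gt0.
  set w := t * #|A|.
  have h2' : t * Z <= 2 * w by rewrite /w; lia.
  lia.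
have [F FP] : exists F : TF, forall A B, good A B -> F \notin ev A B.
  case: (pickP (fun F : TF => [forall AB, good AB.1 AB.2 ==> (F \notin ev AB.1 AB.2)])).
    move=> F /forallP FP; exists F => A B gAB.
    by have /implyP := FP (A, B); apply.
  move=> no; exfalso.
  have : #|{: TF}| <= \sum_(AB | good AB.1 AB.2) #|ev AB.1 AB.2|.
    rewrite -cardsT; apply: leq_trans (card_bigcup_le _ _); apply: subset_leq_card.
    apply/subsetP => F _; have /negbT := no F; rewrite negb_forall => /existsP[AB].
    rewrite negb_imply negbK => /andP[gAB FAB]; apply/bigcupP; exists AB => //.
  have card_gt0 : 0 < #|{: TF}|.
    by rewrite card_ffun card_ffun !card_ord !expn_gt0 q_gt0.
  rewrite -(leq_pmul2l (_ : 0 < 2 ^ (Z + q * D + 1))) ?expn_gt0 // big_distrr /=.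
  have step : \sum_(AB | good AB.1 AB.2) 2 ^ (Z + q * D + 1) * #|ev AB.1 AB.2|
      <= \sum_(AB | good AB.1 AB.2) #|{: TF}|.
    by apply: leq_sum => AB; exact: card_ev.
  move=> /leq_trans/(_ step).
  rewrite sum_nat_const => /leq_trans/(_ (leq_mul (max_card _) (leqnn _))).
  have -> : #|{: {set 'I_Z} * {ffun 'I_D -> {set 'I_q}}}| = 2 ^ (Z + q * D).
    by rewrite card_prod card_ffun !card_set !card_ord -expnM -expnD.
  rewrite leq_mul2r leq_exp2l // => /orP[/eqP|]; first lia.
  by rewrite addn1 ltnn.
exists (fun z => [set F z l | l : 'I_t]) => [z|A Bs leA szB ltB].
  by rewrite (leq_trans (leq_imset_card _ _)) // card_ord.
pose B := [ffun j : 'I_D => nth set0 Bs j].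
have gAB : good A B.
  rewrite /good leA; apply/forallP => j; rewrite ffunE.
  case: (ltnP j (size Bs)) => [lt|le]; first by rewrite ltB ?mem_nth.
  by rewrite nth_default ?cards0.
have := FP A B gAB; rewrite inE negb_forall_in => /exists_inP[z zA zP]; exists z => //.
apply/allP => b bBs; apply: contra zP => /subsetP sb; rewrite inE; apply/existsP.
have lt : index b Bs < D by rewrite (leq_trans _ szB) ?index_mem.
exists (Ordinal lt); apply/forallP => l; rewrite ffunE /= nth_index //.
by apply: sb; apply: imset_f.
Qed.

Lemma heavy_count (T : finType) (X : {set T}) (N : nat) (f : 'I_N -> nat)
    (P : pred T) (g : T -> nat) (R m : nat) :
  (forall a, #|[set b | f b == a]| <= R) ->
  #|[set b | m <= #|[set w in X | P w && (g w == f b)]|]| * m <= #|X| * R.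
Proof.
move=> leR; rewrite -!sum_nat_const.
apply: (@leq_trans (\sum_(b : 'I_N) \sum_(w in X) (P w && (g w == f b)))).
  rewrite [X in _ <= X](bigID (mem [set b | m <= #|[set w in X | P w && (g w == f b)]|])) /=.
  apply: leq_trans (leq_addr _ _); apply: leq_sum => b; rewrite inE => /leq_trans; apply.
  rewrite -sum1_card big_mkcond [X in _ <= X]big_mkcond /=.
  by apply: leq_sum => w _; rewrite !inE; case: (w \in X); case: (P w && _).
rewrite exchange_big /=; apply: leq_sum => w _.
apply: leq_trans (leR (g w)); rewrite -sum1_card [X in _ <= X]big_mkcond /=.
by apply: leq_sum => b _; rewrite inE eq_sym; case: (P w); case: (f b == _).
Qed.

Lemma fiber_val (N a : nat) : #|[set b : 'I_N | val b == a]| <= 1.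
Proof.
apply/card_le1_eqP => b b'; rewrite !inE => /eqP ba /eqP b'a.
by apply: val_inj; rewrite ba b'a.
Qed.

(** * Greedy choice of the coordinates *)

Section Greedy.

Variables (k : nat) (U : finType) (A : {set U}) (src : U -> option 'I_k -> U).
Variables (sc : U -> nat) (q : nat) (Zs Qs Ds : nat -> nat).
Variables (S : nat -> nat -> {set 'I_q}) (C0 : nat).

(* The coordinates of a vertex w are its own label z w (index None) and, for each i, a colour
   x w i taken from the palette of its i-th out-neighbour [src w (Some i)], read modulo a
   number depending on the scale of w. Coordinate c of w is fixed when [src w c] is processed. *)
Definition inset (u : U) : {set U * 'I_k} :=
  [set p | (p.1 \in A) && (src p.1 (Some p.2) == u)].

Definition side (s : nat) (c : option 'I_k) := if c is Some _ then Qs s else Zs s.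

(* The number of slots of scale s with prescribed coordinates in J. *)
Definition room (s : nat) (J : {set option 'I_k}) := \prod_(c in ~: J) side s c.

Fixpoint cap (j : nat) : nat :=
  if j is j'.+1 then 2 ^ (k + 7) * cap j' + (4 * k * k + 2) else C0.

Hypothesis k_gt0 : 0 < k.
Hypothesis src_None : forall w, src w None = w.
Hypothesis src_inj : forall w, w \in A -> injective (src w).
Hypothesis q_gt0 : 0 < q.
Hypothesis Qs_dvd : forall u, Qs (sc u) %| q.
Hypothesis Zs_ge : forall u, q <= Zs (sc u).
Hypothesis C0_gt0 : 0 < C0.
Hypothesis inset_Ds : forall u, #|inset u| <= Ds (sc u).
Hypothesis inset_q : forall u, #|inset u| <= q.
Hypothesis S_sampler : forall u (Z : {set 'I_(Zs (sc u))}) (Bs : seq {set 'I_q}),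
  Zs (sc u) <= 2 * #|Z| -> size Bs <= Ds (sc u) ->
  (forall B : {set 'I_q}, B \in Bs -> 64 * #|B| <= q) ->
  exists2 z, z \in Z & all (fun B : {set 'I_q} => ~~ (S (sc u) (val z) \subset B)) Bs.
Hypothesis scale_card : forall w0, w0 \in A ->
  #|[set w in A | sc w == sc w0]| <= C0 * room (sc w0) set0.

Lemma cap_gt0 j : 0 < cap j.
Proof. by case: j => [|j] //=; rewrite !addn_gt0 !orbT. Qed.

Lemma side_gt0 u c : 0 < side (sc u) c.
Proof.
case: c => [i|] /=; last exact: leq_trans (Zs_ge u).
exact: dvdn_gt0 (Qs_dvd u).
Qed.

Lemma room_gt0 u J : 0 < room (sc u) J.
Proof. by rewrite /room; apply: prodn_cond_gt0 => c _; exact: side_gt0. Qed.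

Lemma roomD1 s (J : {set option 'I_k}) c : c \notin J -> room s J = side s c * room s (c |: J).
Proof.
move=> cJ; rewrite /room (bigD1 c) ?inE //=; congr (_ * _).
by apply: eq_bigl => c'; rewrite !inE negb_or andbC.
Qed.

Lemma room_ge u (J : {set option 'I_k}) : None \notin J -> q <= room (sc u) J.
Proof.
move=> /roomD1->; apply: leq_trans (Zs_ge u) _.
by rewrite leq_pmulr // room_gt0.
Qed.

Lemma fiber_mod u a : #|[set b : 'I_q | b %% Qs (sc u) == a]| <= q %/ Qs (sc u).
Proof.
have Q_gt0 := side_gt0 u (Some (Ordinal k_gt0)); rewrite /= in Q_gt0.
have lt (b : 'I_q) : b %/ Qs (sc u) < q %/ Qs (sc u).
  by rewrite ltn_divLR // divnK ?Qs_dvd.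
rewrite -[X in _ <= X]card_ord.
rewrite -(@card_in_imset _ _ (fun b => Ordinal (lt b))) ?max_card //.
move=> b b'; rewrite !inE => /eqP mb /eqP mb' /(congr1 val)/= eqd.
by apply: val_inj; rewrite /= (divn_eq b (Qs (sc u))) (divn_eq b' (Qs (sc u))) eqd mb mb'.
Qed.

Section State.

Variables (Done : {set U}) (z : U -> nat) (x : U -> 'I_k -> 'I_q).

Definition coordinate (w : U) (c : option 'I_k) : nat :=
  if c is Some i then x w i %% Qs (sc w) else z w.

Definition det (w : U) (J : {set option 'I_k}) := [forall c in J, src w c \in Done].

Definition cell (w0 : U) (J : {set option 'I_k}) : {set U} :=
  [set w in A | (sc w == sc w0) &&
     [forall c in J, (src w c \in Done) && (coordinate w c == coordinate w0 c)]].

Definition twins (w0 : U) (i : 'I_k) (a : nat) : {set U} :=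
  [set w in A | [&& w \in Done, sc w == sc w0, src w (Some i) == src w0 (Some i) & z w == a]].

(* The first bound keeps the load of every partially specified slot proportional to [room].
   The second one is what makes the colours chosen simultaneously for the in-neighbours of
   one vertex harmless: few of these in-neighbours share their label. *)
Definition valid :=
  [/\ forall u, z u < Zs (sc u),
      forall w i, w \in A -> src w (Some i) \in Done ->
        x w i \in S (sc (src w (Some i))) (z (src w (Some i))),
      forall w0 J, w0 \in A -> det w0 J -> #|cell w0 J| <= cap #|J| * room (sc w0) J &
      forall w0 i, w0 \in A -> w0 \in Done -> src w0 (Some i) \notin Done ->
        #|twins w0 i (z w0)| <= 4 * k].

Definition heavy (w : U) (c : option 'I_k) (J : {set option 'I_k}) (b : nat) :=
  2 ^ (k + 7) * cap #|J| * room (sc w) (c |: J)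
    <= #|[set w' in cell w J | (src w' c \in Done) && (coordinate w' c == b)]|.

Definition bad (w : U) (c : option 'I_k) (b : nat) :=
  [exists J : {set option 'I_k}, [&& c \notin J, det w J & heavy w c J b]].

Lemma card_bad (w : U) (c : option 'I_k) (N R : nat) (f : 'I_N -> nat) :
  valid -> w \in A -> (forall a, #|[set b | f b == a]| <= R) -> N = R * side (sc w) c ->
  64 * #|[set b | bad w c (f b)]| <= N.
Proof.
case=> _ _ inv1 _ wA leR defN.
have sub : [set b | bad w c (f b)] \subset
    \bigcup_(J : {set option 'I_k} | (c \notin J) && det w J) [set b | heavy w c J (f b)].
  apply/subsetP => b; rewrite inE => /existsP[J /and3P[cJ dJ hJ]].
  by apply/bigcupP; exists J; rewrite ?cJ // inE.
rewrite -(leq_pmul2l (_ : 0 < 2 ^ k.+1)) ?expn_gt0 // mulnA.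
rewrite (_ : 64 = 2 ^ 6) // -expnD (_ : k.+1 + 6 = k + 7); last by lia.
apply: leq_trans (leq_mul (leqnn _) (leq_trans (subset_leq_card sub) (card_bigcup_le _ _))) _.
rewrite big_distrr /=.
apply: (@leq_trans (\sum_(J : {set option 'I_k} | (c \notin J) && det w J) N)); last first.
  rewrite sum_nat_const leq_mul2r; apply/orP; right.
  by rewrite (leq_trans (max_card _)) // card_set card_option card_ord.
apply: leq_sum => J /andP[cJ dJ].
have := heavy_count (cell w J) (fun w' => src w' c \in Done) (coordinate^~ c)
  (2 ^ (k + 7) * cap #|J| * room (sc w) (c |: J)) leR.
rewrite -[#|_|]/(#|[set b | heavy w c J (f b)]|).
move=> /leq_trans/(_ (leq_mul (inv1 w J wA dJ) (leqnn R))).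
rewrite (roomD1 _ cJ) => le.
rewrite -(leq_pmul2r (_ : 0 < cap #|J| * room (sc w) (c |: J))); last first.
  by rewrite muln_gt0 cap_gt0 room_gt0.
move: #|[set b | _]| le => h le; rewrite [X in _ <= X * _]defN.
move: (cap _) (room _ _) (side _ _) (2 ^ _) le => a b d e le; lia.
Qed.

End State.

Lemma card_inset_fst u (X : {set U}) i :
  {in X, forall w, w \in A /\ src w (Some i) = u} -> #|X| <= q.
Proof.
move=> XP; apply: leq_trans (inset_q u).
rewrite -(@card_imset _ _ (fun w => (w, i))); last by move=> w w' [].
apply/subset_leq_card/subsetP => _ /imsetP[w /XP[wA wu] ->].
by rewrite inE wA wu eqxx.
Qed.

(* A non-heavy value leaves at most 2^(k+7) * cap * room old members in a cell. The new
   members are u and in-neighbours of u: if the cell fixes the label there are at most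
   4k of them for each i, and otherwise at most q <= room. *)
Lemma valid_step Done z x u : valid Done z x -> u \notin Done ->
  exists z' x', valid (u |: Done) z' x'.
Proof.
move=> vD uD; have [lt_z xS inv1 inv2] := vD.
pose crowded (b : nat) := [exists i, 4 * k <= #|twins Done z u i b|].
pose forb := [set b : 'I_(Zs (sc u)) | (u \in A) && (bad Done z x u None b || crowded b)].
have card_forb : 2 * #|forb| <= Zs (sc u).
  case: (boolP (u \in A)) => uA; last first.
    by rewrite (_ : forb = set0) ?cards0 //; apply/setP => b; rewrite !inE (negbTE uA).
  pose B1 := [set b : 'I_(Zs (sc u)) | bad Done z x u None b].
  pose B2 i := [set b : 'I_(Zs (sc u)) | 4 * k <= #|twins Done z u i b|].
  have le1 : 64 * #|B1| <= Zs (sc u).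
    apply: (@card_bad _ _ _ _ _ _ 1) => //; last by rewrite mul1n.
    exact: fiber_val.
  have le2 i : #|B2 i| * (4 * k) <= q.
    pose X := [set w in A | src w (Some i) == src u (Some i)].
    have leX : #|X| <= q.
      by apply: (@card_inset_fst (src u (Some i)) _ i) => w; rewrite inE => /andP[? /eqP].
    have := @heavy_count _ X (Zs (sc u)) val (fun w => (w \in Done) && (sc w == sc u))
      z 1 (4 * k) (@fiber_val _).
    rewrite muln1 => /leq_trans/(_ leX); apply: leq_trans.
    rewrite leq_mul2r; apply/orP; right; apply/subset_leq_card/subsetP => b.
    rewrite !inE => /leq_trans; apply; apply/subset_leq_card/subsetP => w.
    by rewrite !inE => /and5P[-> -> -> -> ->].
  have le3 : #|forb| <= #|B1| + \sum_i #|B2 i|.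
    apply: leq_trans (leq_add (leqnn _) (card_bigcup_le _ _)).
    apply: leq_trans (leq_card_setU _ _); apply/subset_leq_card/subsetP => b.
    rewrite !inE uA /= => /orP[->//|/existsP[i ci]]; apply/orP; right.
    by apply/bigcupP; exists i => //; rewrite inE.
  have le4 : (\sum_i #|B2 i|) * 4 <= q.
    rewrite -(leq_pmul2r k_gt0) -mulnA big_distrl /=.
    apply: (@leq_trans (\sum_(i < k) q)); first by apply: leq_sum.
    by rewrite sum_nat_const card_ord mulnC.
  by move: (Zs_ge u); lia.
pose B w i := [set b : 'I_q | bad Done z x w (Some i) (b %% Qs (sc w))].
have [zu zuP allB] : exists2 zu : 'I_(Zs (sc u)), zu \notin forb &
    forall w i, w \in A -> src w (Some i) = u -> ~~ (S (sc u) zu \subset B w i).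
  pose Bs := [seq B p.1 p.2 | p <- enum (inset u)].
  have := @S_sampler u (~: forb) Bs; case.
  - have := cardsC forb; rewrite card_ord; move: card_forb.
    by move: #|forb| #|~: forb| => a b; lia.
  - by rewrite size_map -cardE.
  - move=> B' /mapP[[w i]]; rewrite mem_enum inE /= => /andP[wA /eqP wu] ->.
    apply: (@card_bad Done z x w (Some i) q (q %/ Qs (sc w))) => //=.
      exact: fiber_mod.
    by rewrite divnK.
  move=> zu; rewrite inE => zuP /allP zuB; exists zu => // w i wA wu.
  by apply: zuB; apply/mapP; exists (w, i); rewrite // mem_enum inE /= wA wu eqxx.
pose pick_x w i := odflt (x w i) [pick b in S (sc u) zu :\: B w i].
have pick_xP w i : w \in A -> src w (Some i) = u ->
    pick_x w i \in S (sc u) zu /\ pick_x w i \notin B w i.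
  move=> wA wu; rewrite /pick_x; case: pickP => [b|no] /=.
    by rewrite inE => /andP[].
  have /subsetPn[b bS bB] := allB w i wA wu.
  by have := no b; rewrite inE bS bB.
pose z' v := if v == u then val zu else z v.
pose x' w i := if src w (Some i) == u then pick_x w i else x w i.
have coordD w c : src w c \in Done -> coordinate z' x' w c = coordinate z x w c.
  move=> wD; have nwu : src w c != u by apply: contraNneq uD => <-.
  case: c wD nwu => [i|] /= wD nwu; first by rewrite /x' (negbTE nwu).
  by move: nwu; rewrite src_None /z' => /negbTE->.
have not_bad w c : w \in A -> src w c = u -> ~~ bad Done z x w c (coordinate z' x' w c).
  case: c => [i|] wA wu /=.
    by rewrite /x' wu eqxx; have [_] := pick_xP w i wA wu; rewrite inE.
  move: wu wA; rewrite src_None => -> uA; rewrite /z' eqxx.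
  by move: zuP; rewrite inE uA /= negb_or => /andP[].
exists z', x'; split.
- by move=> v; rewrite /z'; case: eqP => [->|_]; [exact: ltn_ord | exact: lt_z].
- move=> w i wA; rewrite !inE /x' /z'; case: eqP => [wu _|_ /=]; last exact: xS.
  by rewrite wu; have [] := pick_xP w i wA wu.
- move=> w0 J w0A dJ; set C := cell _ _ _ _ _.
  have memC w : w \in C -> [/\ w \in A, sc w = sc w0 & forall c, c \in J ->
      (src w c = u \/ src w c \in Done) /\ coordinate z' x' w c = coordinate z' x' w0 c].
    rewrite inE => /and3P[wA /eqP ws /forall_inP wJ]; split=> // c /wJ.
    by rewrite in_setU1 => /andP[/orP[/eqP|] ? /eqP]; split; auto.
  have w0C : w0 \in C.
    rewrite inE w0A eqxx /=; apply/forall_inP => c cJ; rewrite eqxx andbT.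
    exact: (forall_inP dJ).
  clearbody C; pose new := [set w in C | [exists c in J, src w c == u]].
  have [new0|[w1]] := set_0Vmem new.
    have allD w c : w \in C -> c \in J -> src w c \in Done.
      move=> wC cJ; have [_ _ /(_ c cJ)[[wu|//] _]] := memC w wC.
      have : w \in new by rewrite inE wC; apply/exists_inP; exists c; rewrite ?wu.
      by rewrite new0 inE.
    apply: leq_trans (inv1 w0 J w0A _); last by apply/forall_inP => c; exact: allD.
    apply/subset_leq_card/subsetP => w wC; have [wA ws wJ] := memC w wC.
    rewrite inE wA ws eqxx /=; apply/forall_inP => c cJ.
    have [_] := wJ c cJ; rewrite allD // !coordD ?allD // => ->; exact: eqxx.
  rewrite inE => /andP[w1C /exists_inP[c1 c1J /eqP w1u]].
  have [w1A w1s w1J] := memC w1 w1C.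
  pose J' := J :\ c1.
  have JE : c1 |: J' = J by rewrite setD1K.
  have cardJ : #|J| = #|J'|.+1 by rewrite (cardsD1 c1) c1J.
  have dJ' : det Done w1 J'.
    apply/forall_inP => c; rewrite !inE => /andP[ncc cJ].
    have [[wu|//] _] := w1J c cJ; case/eqP: ncc; apply: (src_inj w1A).
    by rewrite wu.
  have card_old : #|C :\: new| <= 2 ^ (k + 7) * cap #|J'| * room (sc w0) J.
    have := not_bad w1 c1 w1A w1u; rewrite negb_exists => /forallP/(_ J').
    rewrite dJ' setD11 /= /heavy -ltnNge JE w1s => /ltnW; apply: leq_trans.
    apply/subset_leq_card/subsetP => w; rewrite !inE => /andP[nwn wC].
    have [wA ws wJ] := memC w wC.
    have wD c : c \in J -> src w c \in Done.
      move=> cJ; have [[wu|//] _] := wJ c cJ; case/negP: nwn; rewrite wC /=.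
      by apply/exists_inP; exists c; rewrite ?wu.
    rewrite wA ws w1s eqxx /= wD //= -(coordD _ _ (wD c1 c1J)).
    have [_ ->] := wJ c1 c1J; have [_ ->] := w1J c1 c1J; rewrite eqxx andbT.
    apply/forall_inP => c; rewrite !inE => /andP[ncc cJ]; rewrite wD //=.
    have cJ' : c \in J' by rewrite !inE ncc.
    rewrite -(coordD _ _ (wD c cJ)) -(coordD _ _ (forall_inP dJ' c cJ')).
    by have [_ ->] := wJ c cJ; have [_ ->] := w1J c cJ.
  have card_new : #|new| <= (4 * k * k + 2) * room (sc w0) J.
    pose N i := [set w in C | (Some i \in J) && (src w (Some i) == u)].
    have card_N i : #|N i| <= 4 * k * room (sc w0) J.
      case: (boolP (None \in J)) => NJ; last first.
        apply: (@leq_trans q).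
          apply: (@card_inset_fst u _ i) => w; rewrite inE => /and3P[wC _ /eqP].
          by have [] := memC w wC.
        apply: leq_trans (room_ge w0 NJ) _; rewrite leq_pmull //.
        by rewrite muln_gt0.
      have [->|[w2]] := set_0Vmem (N i); first by rewrite cards0.
      have ND w : w \in N i -> w \in A /\ w \in Done.
        rewrite inE => /and3P[wC _ /eqP wu]; have [wA ws wJ] := memC w wC; split=> //.
        have [[wu'|wD] _] := wJ None NJ; last by rewrite src_None in wD.
        have : src w (Some i) = src w None by rewrite wu wu'.
        by move/(src_inj wA).
      move=> w2N; have [w2A w2D] := ND w2 w2N.
      have /and3P[w2C _ /eqP w2u] : [&& w2 \in C, Some i \in J & src w2 (Some i) == u].
        by move: w2N; rewrite inE.
      have [_ w2s w2J] := memC w2 w2C.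
      apply: (@leq_trans (4 * k)); last by rewrite leq_pmulr ?room_gt0.
      apply: leq_trans (inv2 w2 i w2A w2D _); last by rewrite w2u.
      apply/subset_leq_card/subsetP => w wN; have [wA wD] := ND w wN.
      have /and3P[wC _ /eqP wu] : [&& w \in C, Some i \in J & src w (Some i) == u].
        by move: wN; rewrite inE.
      have [_ ws wJ] := memC w wC.
      rewrite inE wA wD ws w2s wu w2u !eqxx /=.
      have := coordD w None; have := coordD w2 None; rewrite !src_None /=.
      move=> /(_ w2D) <- /(_ wD) <-.
      by have [_ /= ->] := wJ None NJ; have [_ /= ->] := w2J None NJ.
    have sub : new \subset [set u] :|: \bigcup_i N i.
      apply/subsetP => w; rewrite !inE => /andP[wC /exists_inP[[i|] cJ /eqP wu]].
        by apply/orP; right; apply/bigcupP; exists i; rewrite // inE wC cJ wu eqxx.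
      by rewrite -wu src_None eqxx.
    apply: leq_trans (subset_leq_card sub) _.
    apply: leq_trans (leq_card_setU _ _) _; rewrite cards1.
    apply: leq_trans (leq_add (leqnn 1) (card_bigcup_le _ _)) _.
    apply: (@leq_trans (1 + \sum_(i < k) 4 * k * room (sc w0) J)).
      by rewrite leq_add2l; apply: leq_sum.
    rewrite sum_nat_const card_ord; have := room_gt0 w0 J; set r := room _ _.
    move=> r_gt0; rewrite mulnDl addnC; apply: leq_add; last by rewrite muln_gt0.
    by rewrite !mulnA (mulnC k 4).
  rewrite -(cardsID new C) addnC (_ : C :&: new = new); last first.
    by apply/setIidPr/subsetP => w; rewrite inE => /andP[].
  apply: leq_trans (leq_add card_old card_new) _.
  by rewrite cardJ -mulnDl; exact: leqnn.
- move=> w0 i w0A; rewrite !inE => w0D /norP[w0nu w0nD].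
  case: (boolP (u \in twins (u |: Done) z' w0 i (z' w0))) => uT; last first.
    have w0D' : w0 \in Done.
      case/orP: w0D => // /eqP w0u; move: uT; rewrite -w0u !inE w0A !eqxx.
      by [].
    apply: leq_trans (inv2 w0 i w0A w0D' w0nD).
    apply/subset_leq_card/subsetP => w wT; have nwu : w != u.
      by apply: contraNneq uT => wu; move: wT; rewrite {1}wu.
    have nw0u : w0 != u by apply: contraNneq uD => <-.
    by move: wT; rewrite !inE /z' (negbTE nwu) (negbTE nw0u).
  move: (uT); rewrite inE => /and5P[uA _ /eqP us /eqP ui /eqP uz].
  have lt : #|twins Done z u i (z' u)| < 4 * k.
    move: zuP; rewrite inE uA /= negb_or => /andP[_]; rewrite negb_exists => /forallP/(_ i).
    by rewrite -ltnNge /z' eqxx.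
  rewrite (cardsD1 u) uT add1n; apply: leq_trans lt.
  rewrite ltnS; apply/subset_leq_card/subsetP => w; rewrite !inE.
  case/and3P => nwu wA /and4P[wD ws wi wz]; rewrite wA us ui ws wi uz.
  by move: wD wz; rewrite /z' (negbTE nwu) /= => -> ->.
Qed.

Lemma greedy : exists (z : U -> nat) (x : U -> 'I_k -> 'I_q),
  [/\ forall u, z u < Zs (sc u),
      forall w i, w \in A -> x w i \in S (sc (src w (Some i))) (z (src w (Some i))) &
      forall w0, w0 \in A ->
        #|[set w in A | (sc w == sc w0) && [forall c, coordinate z x w c == coordinate z x w0 c]]|
          <= cap k.+1].
Proof.
suff [z [x [lt_z xS inv1 _]]] : exists z x, valid [set: U] z x.
  exists z, x; split=> // [w i wA|w0 w0A]; first by apply: xS; rewrite ?inE.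
  have dT : det [set: U] w0 setT by apply/forall_inP => c _; rewrite inE.
  have := inv1 _ _ w0A dT; rewrite /room setCT big_set0 muln1 cardsT card_option card_ord.
  apply: leq_trans.
  apply/subset_leq_card/subsetP => w; rewrite !inE => /and3P[-> -> /forallP wP] /=.
  by apply/forall_inP => c _; rewrite inE wP.
have [n le_n] := ubnP #|~: (set0 : {set U})|.
have : exists z x, valid set0 z x.
  exists (fun=> 0), (fun _ _ => Ordinal q_gt0); split.
  - by move=> u; apply: leq_trans (Zs_ge u).
  - by move=> w i _; rewrite inE.
  - move=> w0 J w0A dJ; have -> : J = set0.
      by apply/setP => c; rewrite inE; apply/negP => /(forall_inP dJ); rewrite inE.
    rewrite cards0 /=; apply: leq_trans (scale_card w0A).
    by apply/subset_leq_card/subsetP => w; rewrite !inE => /and3P[-> ->].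
  - by move=> w0 i _; rewrite inE.
elim: n (set0 : {set U}) le_n => // n IHn D le_n [z [x vD]].
have [D0|[u uD]] := set_0Vmem (~: D).
  by exists z, x; rewrite -[[set: U]](setCK) setCT -D0 setCK.
rewrite inE in uD; have := valid_step vD uD; apply: IHn.
rewrite -ltnS; apply: leq_trans le_n; rewrite ltnS.
by apply/proper_card; rewrite setCU setIC; apply/properP; split;
  [exact: subsetIl | exists u; rewrite !inE ?eqxx ?uD].
Qed.

End Greedy.

(** * Orientations of bounded out-degree *)

Lemma density_card (H : sgraph) (k : nat) (W : {set H}) (X : {set {set H}}) :
  (density H <= k%:R)%R -> W != set0 -> is_subgraph (W, X) -> #|X| <= k * #|W|.
Proof.
move=> leH W0 sWX.
have : (#|X|%:R / #|W|%:R <= density H)%R.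
  rewrite /density.
  by apply: (@le_bigmax_cond _ _ _ 0%R (W, X) (fun S => is_subgraph S && (S.1 != set0))
    (fun S => #|S.2|%:R / #|S.1|%:R)%R); rewrite sWX.
move=> /le_trans/(_ leH); rewrite ler_pdivrMr ?ltr0n ?card_gt0 //.
by rewrite -natrM ler_nat.
Qed.

Definition oriented (k : nat) (H : sgraph) := exists o : 'I_k -> H -> option H,
  [/\ forall i v u, o i v = Some u -> adj v u,
      forall i j v u, o i v = Some u -> o j v = Some u -> i = j &
      forall x y : H, adj x y -> exists i, o i x = Some y \/ o i y = Some x].

Lemma orientation (H : sgraph) (k : nat) : (density H <= k%:R)%R -> oriented k H.
Proof.
move=> leH; pose E := {e : {set H} | e \in edges H}.
pose r (e : E) : {set H * 'I_k} := setX (val e) setT.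
have [X|g g_inj gP] := @rado _ _ r.
  pose W := \bigcup_(e in X) val e.
  have [->|[e eX]] := set_0Vmem X; first by rewrite cards0.
  have -> : \bigcup_(e in X) r e = setX W setT.
    apply/setP => -[v i]; rewrite !inE andbT.
    by apply/bigcupP/bigcupP => -[e' e'X]; rewrite ?inE ?andbT => ve'; exists e';
      rewrite // !inE ve'.
  rewrite cardsX cardsT card_ord mulnC -(card_imset _ val_inj).
  apply: density_card leH _ _.
    have /imsetP[[x y] _ eE] := valP e.
    apply/set0Pn; exists x; apply/bigcupP; exists e => //.
    by rewrite [val e]eE !inE eqxx.
  apply/andP; split => /=.
    by apply/subsetP => _ /imsetP[e' _ ->]; exact: valP.
  by apply/forall_inP => _ /imsetP[e' e'X ->]; exact: (bigcup_sup e').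
pose P i v u := adj v u && [exists e : E, (val e == [set v; u]) && (g e == (v, i))].
pose o i v := [pick u | P i v u].
have oP i v u : o i v = Some u -> adj v u /\ exists e : E, val e = [set v; u] /\ g e = (v, i).
  rewrite /o; case: pickP => // u' /andP[vu' /existsP[e /andP[/eqP e1 /eqP e2]]] [<-].
  by split=> //; exists e.
have o_ex i (x y : H) (e : E) : adj x y -> val e = [set x; y] -> g e = (x, i) ->
    o i x = Some y.
  move=> xy eE ge; case E1 : (o i x) => [u|]; last first.
    move: E1; rewrite /o; case: pickP => // /(_ y); rewrite /P xy /= => /existsP[].
    by exists e; rewrite eE ge !eqxx.
  have [xu [e' [e'E ge']]] := oP _ _ _ E1.
  have ee' : e = e' by apply: g_inj; rewrite ge ge'.
  have : u \in [set x; y] by rewrite -eE ee' e'E !inE eqxx orbT.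
  by rewrite !inE => /orP[/eqP ux|/eqP->] //; rewrite ux adj_irrefl in xu.
exists o; split=> [i v u /oP[]//|i j v u|x y xy].
  move=> /oP[_ [e [eE ge]]] /oP[_ [e' [e'E ge']]].
  have ee' : e = e' by apply: val_inj; rewrite eE e'E.
  by move: ge'; rewrite -ee' ge => -[].
have xyE : [set x; y] \in edges H by apply/imsetP; exists (x, y); rewrite ?inE.
pose e : E := Sub [set x; y] xyE; have := gP e.
case ge : (g e) => [v i]; rewrite !inE andbT /= => /orP[/eqP vx|/eqP vy]; exists i.
  by left; apply: (o_ex _ _ _ e) => //; rewrite ge vx.
right; apply: (o_ex _ _ _ e); rewrite ?ge ?vy //; first by rewrite adj_sym.
exact: setUC.
Qed.

(** * The universal graph *)

Lemma geometric_sum (a : nat -> nat) (X n : nat) :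
  (forall s, s < n -> a s * 2 ^ s <= X) -> \sum_(s < n) a s <= 2 * X.
Proof.
move=> le_a; suff : 2 ^ n * (\sum_(s < n) a s) + 2 * X <= 2 ^ n * (2 * X).
  move/(leq_trans (leq_addr _ _)); rewrite leq_pmul2l ?expn_gt0 //.
elim: n le_a => [|n IHn] le_a; first by rewrite big_ord0 muln0 mul1n.
have /IHn {}IHn : forall s, s < n -> a s * 2 ^ s <= X by move=> s /ltnW; exact: le_a.
rewrite big_ord_recr /= expnS; have := le_a n (ltnSn n).
move: (\sum_(_ < n) _) (2 ^ n) (a n) IHn => b e c; lia.
Qed.

Section Construction.

Variables (k m M : nat).
Hypothesis k_gt1 : 1 < k.

Let q := 2 ^ m.
(* Scale s collects the vertices of in-degree about 4^(ks). Their labels range over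
   [Zsize s] values, they offer 2^(ks) colours to their in-neighbours, and they read the
   colours offered to them modulo [Qsize s]. Both sums over s that bound the number
   of edges are then geometric, because k >= 2. *)
Definition Zsize s := 2 ^ (m + k * s).
Definition Qsize s := 2 ^ (m - 3 * s).
Definition smax := m %/ (2 * k).

Lemma smax_le s : s <= smax -> 3 * s <= m.
Proof.
have k2 : 0 < 2 * k by lia.
rewrite /smax leq_divRL // => le; apply: leq_trans le.
by rewrite (mulnC 3) leq_mul2l; apply/orP; right; lia.
Qed.

Variable S : nat -> nat -> {set 'I_q}.
Hypothesis S_card : forall s z, #|S s z| <= 2 ^ (k * s).
Variable h : nat.

Definition slot (s : 'I_smax.+1) : finType :=
  ('I_(Zsize s) * {ffun 'I_k -> 'I_(Qsize s)} * 'I_M)%type.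

Definition link (p p' : {s & slot s}) :=
  [exists i, [exists a in S (tag p') (tagged p').1.1,
     a %% Qsize (tag p) == (tagged p).1.2 i]].

Definition host_adj : rel ({s & slot s} + 'I_h) := fun v v' =>
  (v != v') && match v, v' with
    | inl p, inl p' => link p p' || link p' p
    | _, _ => true
    end.

Lemma host_adj_sym : symmetric host_adj.
Proof.
by move=> [p|p] [p'|p']; rewrite /host_adj eq_sym // orbC.
Qed.

Lemma host_adj_irrefl : irreflexive host_adj.
Proof. by move=> v; rewrite /host_adj eqxx. Qed.

Definition host := SGraph host_adj_sym host_adj_irrefl.

Lemma card_slot s : #|slot s| = Zsize s * Qsize s ^ k * M.
Proof. by rewrite /slot !card_prod card_ffun !card_ord. Qed.

Lemma slot_size s : s <= smax ->
  2 ^ (k * s) * (Zsize s * Qsize s ^ k * M) * 2 ^ s <= M * 2 ^ (m * k.+1).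
Proof.
move=> /smax_le le; rewrite mulnAC (mulnC _ M) mulnA (mulnC _ M) -!mulnA leq_mul2l.
apply/orP; right; rewrite /Zsize /Qsize -expnM -!expnD leq_exp2l //.
rewrite mulnBl; nia.
Qed.

Lemma slot_line_size s : s <= smax ->
  Zsize s * Qsize s ^ k.-1 * 2 ^ s <= 2 ^ (m * k).
Proof.
move=> /smax_le le; rewrite /Zsize /Qsize -expnM -!expnD leq_exp2l //.
by case: k k_gt1 => // j j_gt0 /=; rewrite mulnBl; nia.
Qed.

Lemma sum_weight : \sum_(p : {s & slot s}) 2 ^ (k * tag p) <= 2 * (M * 2 ^ (m * k.+1)).
Proof.
rewrite -(@sig_big_dep _ _ _ _ slot xpredT (fun _ => xpredT) (fun s _ => 2 ^ (k * s))) /=.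
apply: (@leq_trans (\sum_(s < smax.+1) 2 ^ (k * s) * (Zsize s * Qsize s ^ k * M))).
  by apply: leq_sum => s _; rewrite sum_nat_const card_slot mulnC.
apply: (@geometric_sum (fun s => 2 ^ (k * s) * (Zsize s * Qsize s ^ k * M))) => s.
by rewrite ltnS; exact: slot_size.
Qed.

Lemma card_slots : #|{: {s & slot s}}| <= 2 * (M * 2 ^ (m * k.+1)).
Proof.
apply: leq_trans sum_weight; rewrite -sum1_card.
by apply: leq_sum => p _; rewrite expn_gt0.
Qed.

Lemma card_link_slot s p' :
  #|[set u : slot s | link (Tagged slot u) p']|
    <= k * 2 ^ (k * tag p') * (Zsize s * Qsize s ^ k.-1 * M).
Proof.
pose F i a := [set u : slot s | a %% Qsize s == u.1.2 i].
have card_F i a : #|F i a| <= Zsize s * Qsize s ^ k.-1 * M.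
  pose Y := family (fun j => if j == i then [pred y : 'I_(Qsize s) | val y == a %% Qsize s]
    else predT).
  have card_Y : #|Y| <= Qsize s ^ k.-1.
    rewrite card_family foldrE big_map big_enum /= (bigD1 i) //= eqxx.
    rewrite (eq_bigr (fun=> Qsize s)); last first.
      by move=> j /negbTE->; rewrite card_ord.
    rewrite prod_nat_const cardC1 card_ord -[X in _ <= X]mul1n leq_mul2r; apply/orP; right.
    by rewrite -cardsE fiber_val.
  apply: (@leq_trans #|setX (setX [set: 'I_(Zsize s)] [set y in Y]) [set: 'I_M]|).
    apply/subset_leq_card/subsetP => -[[z y] r]; rewrite inE => /eqP ay.
    rewrite !in_setX !in_setT /= andbT in_set.
    by apply/familyP => j; case: eqP => // ->; rewrite inE ay.
  by rewrite !cardsX !cardsT !card_ord cardsE leq_mul2r leq_mul2l card_Y !orbT.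
apply: (@leq_trans #|\bigcup_i \bigcup_(a in S (tag p') (tagged p').1.1) F i a|).
  apply/subset_leq_card/subsetP => u; rewrite inE => /existsP[i /exists_inP[a aS ai]].
  by apply/bigcupP; exists i => //; apply/bigcupP; exists a; rewrite ?inE.
apply: leq_trans (card_bigcup_le _ _) _.
apply: (@leq_trans (\sum_(i < k) 2 ^ (k * tag p') * (Zsize s * Qsize s ^ k.-1 * M))).
  apply: leq_sum => i _; apply: leq_trans (card_bigcup_le _ _) _.
  apply: (@leq_trans (\sum_(a in S (tag p') (tagged p').1.1) Zsize s * Qsize s ^ k.-1 * M)).
    by apply: leq_sum => a _.
  by rewrite sum_nat_const leq_mul2r S_card orbT.
by rewrite sum_nat_const card_ord mulnA.
Qed.

Lemma card_link :
  #|[set pp : {s & slot s} * {s & slot s} | link pp.1 pp.2]|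
    <= 4 * k * M * M * 2 ^ (m * (2 * k + 1)).
Proof.
have -> : #|[set pp : {s & slot s} * {s & slot s} | link pp.1 pp.2]| =
    \sum_(p' : {s & slot s}) \sum_(s < smax.+1) #|[set u : slot s | link (Tagged slot u) p']|.
  rewrite -sum1_card big_mkcond /=.
  rewrite (eq_bigr (fun pp => (link pp.1 pp.2 : nat))); last first.
    by move=> pp _; rewrite inE; case: link.
  rewrite -(pair_bigA _ (fun p p' => (link p p' : nat))) exchange_big /=.
  apply: eq_bigr => p' _; rewrite (eq_bigr (fun s =>
    \sum_(u : slot s) (link (Tagged slot u) p' : nat))); last first.
    move=> s _; rewrite -sum1_card big_mkcond /=; apply: eq_bigr => u _.
    by rewrite inE; case: link.
  rewrite (@sig_big_dep _ _ _ _ slot xpredT (fun _ => xpredT)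
    (fun s u => (link (Tagged slot u) p' : nat))) /=.
  by apply: eq_bigr => -[].
pose L s := Zsize s * Qsize s ^ k.-1.
apply: (@leq_trans (\sum_(p' : {s & slot s}) 2 ^ (k * tag p') * (k * M * (2 * 2 ^ (m * k))))).
  apply: leq_sum => p' _.
  apply: (@leq_trans (\sum_(s < smax.+1) (2 ^ (k * tag p') * (k * M)) * L s)).
    apply: leq_sum => s _; apply: leq_trans (card_link_slot _ _) _; rewrite /L.
    by apply/eq_leq; move: (2 ^ _) (Zsize s) (Qsize s ^ _) => a b c; lia.
  rewrite -big_distrr /= -mulnA leq_mul2l; apply/orP; right; rewrite leq_mul2l; apply/orP; right.
  by apply: geometric_sum => s; rewrite ltnS; exact: slot_line_size.
rewrite -big_distrl /=; apply: leq_trans (leq_mul sum_weight (leqnn _)) _.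
rewrite (_ : m * (2 * k + 1) = m * k.+1 + m * k); last by lia.
by rewrite expnD; apply/eq_leq; lia.
Qed.

Lemma card_edges_host : h <= 2 ^ (m * k) * k * 4 ^ k ->
  #|edges host| <= (8 * k * M * M + 2 * (k * 4 ^ k) * (2 * M + k * 4 ^ k)) * 2 ^ (m * (2 * k + 1)).
Proof.
move=> le_h; pose V := ({s & slot s} + 'I_h)%type.
pose L := [set pp : {s & slot s} * {s & slot s} | link pp.1 pp.2].
pose L1 := (fun pp : {s & slot s} * {s & slot s} => (inl pp.1 : V, inl pp.2 : V)) @: L.
pose L2 := (fun pp : {s & slot s} * {s & slot s} => (inl pp.2 : V, inl pp.1 : V)) @: L.
pose Hu := [set (inr i : V) | i : 'I_h].
have card_Hu : #|Hu| <= h by rewrite (leq_trans (leq_imset_card _ _)) ?card_ord.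
have le_V : #|{: V}| <= 2 * (M * 2 ^ (m * k.+1)) + h.
  by rewrite card_sum card_ord leq_add2r card_slots.
apply: leq_trans (leq_imset_card _ _) _.
apply: (@leq_trans #|L1 :|: L2 :|: setX Hu setT :|: setX setT Hu|).
  apply/subset_leq_card/subsetP => -[v v']; rewrite !inE /= /host_adj => /andP[_].
  have HuP i : (inr i : V) \in Hu by apply/imsetP; exists i.
  case: v => [p|i]; last by rewrite HuP /= !orbT.
  case: v' => [p'|i]; last by rewrite HuP /= !orbT.
  case/orP => [pp'|pp'].
    apply/orP; left; apply/orP; left; apply/orP; left.
    by apply/imsetP; exists (p, p'); rewrite ?inE.
  apply/orP; left; apply/orP; left; apply/orP; right.
  by apply/imsetP; exists (p', p); rewrite ?inE.
have le_L : #|L| <= 4 * k * M * M * 2 ^ (m * (2 * k + 1)) := card_link.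
have le_L1 : #|L1| <= 4 * k * M * M * 2 ^ (m * (2 * k + 1)).
  by rewrite (leq_trans (leq_imset_card _ _)).
have le_L2 : #|L2| <= 4 * k * M * M * 2 ^ (m * (2 * k + 1)).
  by rewrite (leq_trans (leq_imset_card _ _)).
have le_hV : #|Hu| * #|{: V}| <= k * 4 ^ k * (2 * M + k * 4 ^ k) * 2 ^ (m * (2 * k + 1)).
  apply: leq_trans (leq_mul (leq_trans card_Hu le_h) le_V) _.
  have le_h' : h <= 2 ^ (m * k.+1) * k * 4 ^ k.
    apply: leq_trans le_h _; rewrite -!mulnA leq_mul2r leq_exp2l // leq_mul2l leqnSn.
    by rewrite !orbT.
  apply: leq_trans (leq_mul (leqnn _) (leq_add (leqnn _) le_h')) _.
  rewrite (_ : m * (2 * k + 1) = m * k.+1 + m * k); last by lia.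
  by rewrite expnD; apply/eq_leq; move: (4 ^ k) (2 ^ (m * k.+1)) (2 ^ (m * k)) => a b c; lia.
have := leq_card_setU (L1 :|: L2 :|: setX Hu setT) (setX setT Hu).
have := leq_card_setU (L1 :|: L2) (setX Hu setT); have := leq_card_setU L1 L2.
rewrite !cardsX !cardsT => le1 le2 le3; apply: (leq_trans le3).
apply: leq_trans (leq_add le2 (leqnn _)) _; rewrite -addnA.
apply: leq_trans (leq_add le1 (leqnn _)) _; move=> {le1 le2 le3}.
rewrite [#|{: V}| * _]mulnC.
apply: leq_trans (leq_add (leq_add le_L1 le_L2) (leq_add le_hV le_hV)) _.
by apply/eq_leq; move: (2 ^ (m * (2 * k + 1))) (4 ^ k) => a b; lia.
Qed.

End Construction.

(** * Embedding *)

Lemma leq_double_exp a : 2 * a <= 2 ^ a.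
Proof. by case: a => // a; rewrite expnS leq_pmul2l // ltn_expl. Qed.

Lemma exp4 a : 4 ^ a = 2 ^ (2 * a).
Proof. by rewrite expnM. Qed.

Lemma sampler_family k m : exists2 S : nat -> nat -> {set 'I_(2 ^ m)},
  forall s z, #|S s z| <= 2 ^ (k * s) &
  forall s (Z : {set 'I_(Zsize k m s)}) (Bs : seq {set 'I_(2 ^ m)}),
    s <= smax k m -> Zsize k m s <= 2 * #|Z| -> size Bs <= 4 ^ (k * s) ->
    (forall B : {set 'I_(2 ^ m)}, B \in Bs -> 64 * #|B| <= 2 ^ m) ->
    exists2 z, z \in Z & all (fun B : {set 'I_(2 ^ m)} => ~~ (S s (val z) \subset B)) Bs.
Proof.
have ex (s : 'I_(smax k m).+1) : exists2 S : nat -> {set 'I_(2 ^ m)},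
    forall z, #|S z| <= 2 ^ (k * s) &
    forall (Z : {set 'I_(Zsize k m s)}) (Bs : seq {set 'I_(2 ^ m)}),
      Zsize k m s <= 2 * #|Z| -> size Bs <= 4 ^ (k * s) ->
      (forall B : {set 'I_(2 ^ m)}, B \in Bs -> 64 * #|B| <= 2 ^ m) ->
      exists2 z, z \in Z & all (fun B : {set 'I_(2 ^ m)} => ~~ (S (val z) \subset B)) Bs.
  have leD : 4 ^ (k * s) <= 2 ^ 2 ^ (k * s).
    by rewrite exp4 leq_exp2l ?leq_double_exp.
  have le_tZ : 2 ^ m * 4 ^ (k * s) <= 2 ^ (k * s) * Zsize k m s.
    by rewrite /Zsize exp4 -!expnD leq_exp2l //; lia.
  have gt0 a : 0 < 2 ^ a by rewrite expn_gt0.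
  have [S S_card SP] := sampler (gt0 m) (gt0 _) (gt0 _) leD le_tZ.
  exists (fun n => if insub n is Some z then S z else set0) => [n|Z Bs leZ szB leB].
    by case: insubP => [z _ _|_]; rewrite ?cards0.
  have [z zZ zP] := SP Z Bs leZ szB leB; exists z => //.
  by apply: sub_all zP => B; rewrite valK.
have [S S_card SP] := fin_all_exists2 ex.
pose S' s n : {set 'I_(2 ^ m)} := if s <= smax k m then S (inord s) n else set0.
exists S' => [s n|s Z Bs le_s].
  rewrite /S'; case: ifP => [le_s|_]; last by rewrite cards0.
  by have := S_card (inord s) n; rewrite inordK.
have := SP (inord s); rewrite inordK // => /(_ Z Bs) sP leZ szB leB.
by have [z zZ zP] := sP leZ szB leB; exists z; rewrite /S' ?le_s.
Qed.

Section Embedding.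

Variables (k m : nat) (H : sgraph) (o : 'I_k -> H -> option H).
Hypothesis k_gt1 : 1 < k.
Hypothesis card_H : #|H| <= 2 ^ (m * k.+1).
Hypothesis o_adj : forall i v u, o i v = Some u -> adj v u.
Hypothesis o_inj : forall i j v u, o i v = Some u -> o j v = Some u -> i = j.

Let P := 4 ^ k.

Definition indeg u := #|[set p : H * 'I_k | o p.2 p.1 == Some u]|.

Definition hub u := P ^ smax k m < indeg u.

(* A missing out-neighbour, or one that is a hub, puts no constraint on its tail; it is
   replaced by a private dummy vertex [inr (w, i)]. *)
Definition source (v : H + H * 'I_k) (c : option 'I_k) : H + H * 'I_k :=
  if v is inl w then
    if c is Some i then
      if o i w is Some u then if hub u then inr (w, i) else inl u else inr (w, i)
    else v
  else v.

Definition scale (v : H + H * 'I_k) : nat :=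
  if v is inl w then minn (smax k m) (up_log P (indeg w)) else 0.

Definition tails : {set H + H * 'I_k} := [set v | if v is inl w then ~~ hub w else false].

Let k_gt0 : 0 < k := ltnW k_gt1.

Let P_gt1 : 1 < P.
Proof. by rewrite /P -{1}(expn0 4) ltn_exp2l. Qed.

Let P_gt0 : 0 < P := ltnW P_gt1.

Lemma sum_indeg : \sum_u indeg u <= #|H| * k.
Proof.
rewrite -[X in _ * X]card_ord -card_prod -sum1_card.
rewrite (eq_bigr (fun u => \sum_p (o p.2 p.1 == Some u : nat))); last first.
  by move=> u _; rewrite /indeg -sum1_card big_mkcond; apply: eq_bigr => p _;
    rewrite inE; case: eqP.
rewrite exchange_big; apply: leq_sum => p _; case: (o p.2 p.1) => [v|]; last by rewrite big1.
by rewrite (bigD1 v) //= eqxx big1 // => u nuv; rewrite (inj_eq (@Some_inj _)) eq_sym (negbTE nuv).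
Qed.

Lemma markov_indeg (X : {set H}) a : {in X, forall u, a <= indeg u} -> #|X| * a <= #|H| * k.
Proof.
move=> le_a; apply: leq_trans sum_indeg; rewrite -sum_nat_const.
rewrite [X in _ <= X](bigID (mem X)) /=; apply: leq_trans (leq_addr _ _).
exact: leq_sum.
Qed.

Lemma smax_bounds : P ^ smax k m <= 2 ^ m < P ^ (smax k m).+1.
Proof.
have k2 : 0 < 2 * k by lia.
rewrite /P !exp4 -!expnM leq_exp2l // ltn_exp2l // [_ * smax k m]mulnC.
by rewrite /smax leq_divM mulnC ltn_ceil.
Qed.

Lemma card_hub : #|[set u | hub u]| <= 2 ^ (m * k) * k * 4 ^ k.
Proof.
have /andP[_ /ltnW lt] := smax_bounds.
have le : #|[set u | hub u]| * P ^ smax k m <= #|H| * k.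
  by apply: markov_indeg => u; rewrite inE => /ltnW.
rewrite -(leq_pmul2r (_ : 0 < 2 ^ m)) ?expn_gt0 //.
apply: leq_trans (leq_mul (leqnn _) lt) _; rewrite expnS -/P mulnCA mulnC.
apply: leq_trans (leq_mul le (leqnn P)) _; rewrite -!mulnA mulnCA.
rewrite mulnA; apply: leq_trans (leq_mul (leq_mul (leqnn k) card_H) (leqnn P)) _.
rewrite mulnS expnD -/P; move: (2 ^ m) (2 ^ (m * k)) P => a b c; apply/eq_leq; lia.
Qed.

Lemma source_inj w : w \in tails -> injective (source w).
Proof.
case: w => [w|p]; rewrite inE // => _.
have o_neq i v : o i w = Some v -> w <> v.
  by move=> /o_adj wv wv'; rewrite -wv' adj_irrefl in wv.
move=> [i|] [j|] //=.
- case Ei : (o i w) => [u|]; case Ej : (o j w) => [v|]; last by case=> ->.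
  + case: ifP => _; case: ifP => _ //; first by case=> ->.
    by case=> uv; rewrite uv in Ei; rewrite (o_inj Ei Ej).
  + by case: ifP => // _ [->].
  + by case: ifP => // _ [->].
- by case Ei : (o i w) => [u|] //; case: ifP => // _ [uw]; case: (o_neq _ _ Ei).
- by case Ej : (o j w) => [u|] //; case: ifP => // _ [uw]; case: (o_neq _ _ Ej).
Qed.

Lemma scale_le v : scale v <= smax k m.
Proof. by case: v => [w|//]; exact: geq_minl. Qed.

Lemma card_inset v : #|inset tails source v| <= P ^ scale v.
Proof.
case: v => [u|[w i]] /=.
  case: (boolP (hub u)) => hu.
    rewrite (_ : inset _ _ _ = set0) ?cards0 //; apply/setP => -[[w|p] i]; rewrite !inE //=.
    case: (o i w) => [v|]; rewrite ?andbF //; case: ifP => hv; rewrite ?andbF //.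
    by apply/andP => -[_ /eqP[vu]]; rewrite vu hu in hv.
  have le_u : up_log P (indeg u) <= smax k m by rewrite up_log_min // leqNgt.
  rewrite (minn_idPr le_u); apply: leq_trans (up_logP _ P_gt1).
  rewrite /indeg -(card_imset _ (_ : injective
    (fun p : H * 'I_k => (inl p.1 : H + H * 'I_k, p.2)))).
    apply/subset_leq_card/subsetP => -[[w|p] i]; rewrite !inE //= => /andP[_].
    case E : (o i w) => [v|//]; case: ifP => // _ /eqP[vu].
    by apply/imsetP; exists (w, i); rewrite // inE /= E vu.
  by move=> [w i] [w' i'] [-> ->].
rewrite expn0 -(cards1 (inl w : H + H * 'I_k, i)); apply/subset_leq_card/subsetP => -[[w'|p] j].
  rewrite !inE /= => /andP[_]; case: (o j w') => [v|]; last by move=> /eqP[-> ->].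
  by case: ifP => // _ /eqP[-> ->].
by rewrite !inE.
Qed.

Lemma room_set0 s : s <= smax k m ->
  room (Zsize k m) (Qsize m) s (set0 : {set option 'I_k}) * P ^ s = 2 ^ (m * k.+1).
Proof.
move=> /(smax_le k_gt1) le; rewrite /room setC0.
rewrite (eq_bigl xpredT); last by move=> c; rewrite inE.
rewrite (bigD1 None) //= (eq_bigr (fun=> Qsize m s)); last by case.
rewrite prod_nat_const (eq_card (_ : _ =i predC1 None)) // cardC1 card_option card_ord /=.
rewrite /Zsize /Qsize /P (_ : 4 = 2 ^ 2) // -!expnM -!expnD; congr (2 ^ _).
by rewrite mulnBl; nia.
Qed.

Lemma card_scale w0 : w0 \in tails ->
  #|[set w in tails | scale w == scale w0]|
    <= k * P * room (Zsize k m) (Qsize m) (scale w0) (set0 : {set option 'I_k}).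
Proof.
move=> _; have le_s := scale_le w0; move: (scale w0) le_s => s le_s.
pose X := [set u : H | (~~ hub u) && (scale (inl u) == s)].
have le_X : #|[set w in tails | scale w == s]| <= #|X|.
  rewrite -(card_imset _ (_ : injective (inl : H -> H + H * 'I_k))); last by move=> ? ? [].
  apply/subset_leq_card/subsetP => -[w|p]; rewrite !inE //= => /andP[hw sw].
  by apply/imsetP; exists w; rewrite // inE hw.
apply: leq_trans le_X _; rewrite -(leq_pmul2r (_ : 0 < P ^ s)) ?expn_gt0 ?P_gt0 //.
rewrite -mulnA room_set0 //.
case: s le_s @X => [|s] le_s X.
  rewrite muln1; apply: leq_trans (max_card _) _; apply: leq_trans card_H _.
  by rewrite leq_pmull // muln_gt0 k_gt0.
rewrite expnS mulnCA (mulnC k) -mulnA leq_mul2l; apply/orP; right.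
apply: leq_trans (_ : #|H| * k <= _); last by rewrite mulnC leq_mul2l card_H orbT.
apply: markov_indeg => u; rewrite inE => /andP[hu /eqP su].
rewrite leqNgt; apply/negP => lt.
have : scale (inl u) <= s by rewrite /= geq_min (up_log_min P_gt1 (ltnW lt)) orbT.
by rewrite su ltnn.
Qed.

Hypothesis o_cover : forall x y : H, adj x y -> exists i, o i x = Some y \/ o i y = Some x.

Variable S : nat -> nat -> {set 'I_(2 ^ m)}.
Hypothesis S_sampler : forall s (Z : {set 'I_(Zsize k m s)}) (Bs : seq {set 'I_(2 ^ m)}),
  s <= smax k m -> Zsize k m s <= 2 * #|Z| -> size Bs <= 4 ^ (k * s) ->
  (forall B : {set 'I_(2 ^ m)}, B \in Bs -> 64 * #|B| <= 2 ^ m) ->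
  exists2 z, z \in Z & all (fun B : {set 'I_(2 ^ m)} => ~~ (S s (val z) \subset B)) Bs.

Lemma embeds_host :
  embeds H (host k (cap k (k * P) k.+1) S (2 ^ (m * k) * k * 4 ^ k)).
Proof.
set M := cap _ _ _; set h := 2 ^ (m * k) * k * 4 ^ k.
have PE s : P ^ s = 4 ^ (k * s) by rewrite /P expnM.
have [|||||||||||z [x [lt_z xS load]]] := @greedy k _ tails source scale (2 ^ m)
  (Zsize k m) (Qsize m) (fun s => 4 ^ (k * s)) S (k * P).
- exact: k_gt0.
- by case.
- exact: source_inj.
- by rewrite expn_gt0.
- by move=> u; rewrite /Qsize dvdn_exp2l // leq_subr.
- by move=> u; rewrite /Zsize leq_exp2l // leq_addr.
- by rewrite muln_gt0 k_gt0.
- by move=> u; rewrite -PE card_inset.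
- move=> u; apply: leq_trans (card_inset u) _.
  have /andP[le _] := smax_bounds; apply: leq_trans le.
  by rewrite leq_exp2l // scale_le.
- by move=> u Z Bs; apply: S_sampler; exact: scale_le.
- exact: card_scale.
pose crd := coordinate scale (Qsize m) z x.
pose mates w := [set w' in tails | (scale w' == scale w) && [forall c, crd w' c == crd w c]].
have mates_self w : w \in tails -> w \in mates w.
  by move=> wA; rewrite inE wA eqxx; apply/forallP.
have mates_eq w w' : scale w = scale w' -> crd w =1 crd w' -> mates w = mates w'.
  move=> sw cw; apply/setP => v; rewrite !inE sw; congr [&& _, _ & _].
  by apply: eq_forallb => c; rewrite cw.
have tailP u : ~~ hub u -> inl u \in tails by rewrite inE.
have Q_gt0 s : 0 < Qsize m s by rewrite expn_gt0.
have M_gt0 : 0 < M by apply: cap_gt0; rewrite muln_gt0 k_gt0.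
have h_gt0 : 0 < h by rewrite !muln_gt0 !expn_gt0 k_gt0.
pose slots := {s & @slot k m M s}.
pose rank u := index (inl u) (enum (mates (inl u))).
have so u : scale (inl u) < (smax k m).+1 by rewrite ltnS scale_le.
pose place u : slots :=
  Tagged (@slot k m M) (i := Ordinal (so u))
    ((Ordinal (lt_z (inl u)),
     [ffun i => Ordinal (ltn_pmod (x (inl u) i) (Q_gt0 (scale (inl u))))],
     insubd (Ordinal M_gt0) (rank u)) : @slot k m M (Ordinal (so u))).
have placeP u : ~~ hub u -> val (tagged (place u)).2 = rank u.
  move=> /tailP uA; apply: (@insubdK _ _ 'I_M); apply: leq_trans (load _ uA).
  by rewrite cardE index_mem mem_enum mates_self.
have place_inj u u' : ~~ hub u -> ~~ hub u' -> place u = place u' -> u = u'.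
  move=> hu hu' eq_p; have eq_s : scale (inl u) = scale (inl u').
    exact (congr1 (fun p : slots => val (tag p)) eq_p).
  have eq_z : z (inl u) = z (inl u').
    exact (congr1 (fun p : slots => val (tagged p).1.1) eq_p).
  have eq_r : rank u = rank u'.
    by have := congr1 (fun p : slots => val (tagged p).2) eq_p; rewrite !placeP.
  have eq_c : crd (inl u) =1 crd (inl u').
    case=> [i|] //; have := congr1 (fun p : slots => val ((tagged p).1.2 i)) eq_p.
    by rewrite /= !ffunE.
  move: eq_r; rewrite /rank (mates_eq _ _ eq_s eq_c) => eq_r.
  have uM : inl u \in enum (mates (inl u')).
    by rewrite mem_enum -(mates_eq _ _ eq_s eq_c) mates_self ?tailP.
  have uM' : inl u' \in enum (mates (inl u')) by rewrite mem_enum mates_self ?tailP.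
  by have := congr1 (nth (inl u) (enum (mates (inl u')))) eq_r; rewrite !nth_index // => -[].
pose hub_id u : 'I_h := insubd (Ordinal h_gt0) (index u (enum [set u | hub u])).
have hub_idP u : hub u -> val (hub_id u) = index u (enum [set u | hub u]).
  move=> hu; apply: (@insubdK _ _ 'I_h); apply: leq_trans card_hub.
  by rewrite cardE index_mem mem_enum inE.
pose f u : host k M S h := if hub u then inr (hub_id u) else inl (place u).
have f_inj : injective f.
  move=> u u'; rewrite /f; case: (boolP (hub u)) => hu; case: (boolP (hub u')) => hu' //.
    case=> /(congr1 val); rewrite !hub_idP // => /(congr1 (nth u (enum [set u | hub u]))).
    by rewrite !nth_index // mem_enum inE.
  move=> eq_f; apply: place_inj => //.
  exact (congr1 (fun v : slots + 'I_h => if v is inl p then p else place u) eq_f).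
have linkP u u' i : ~~ hub u' -> ~~ hub u -> o i u = Some u' -> link S (place u) (place u').
  move=> hu' hu oE; have srcE : source (inl u) (Some i) = inl u' by rewrite /= oE (negbTE hu').
  apply/existsP; exists i; apply/exists_inP; exists (x (inl u) i).
    by have := xS (inl u) i (tailP u hu); rewrite srcE.
  by rewrite /= ffunE.
exists f => // u u' uu'; rewrite /= /host_adj; apply/andP; split.
  by rewrite (inj_eq f_inj); apply: contraTneq uu' => ->; rewrite adj_irrefl.
rewrite /f; case: (boolP (hub u)) => hu //; case: (boolP (hub u')) => hu' //.
by have [i [oE|oE]] := o_cover uu'; rewrite (linkP _ _ _ _ _ oE) ?orbT.
Qed.

End Embedding.

Lemma oriented_universal (k : nat) : 1 < k -> exists c : nat, forall m : nat, exists G : sgraph,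
  #|edges G| <= c * 2 ^ (m * (2 * k + 1)) /\
  forall H : sgraph, #|H| <= 2 ^ (m * k.+1) -> oriented k H -> embeds H G.
Proof.
move=> k_gt1; pose M := cap k (k * 4 ^ k) k.+1.
exists (8 * k * M * M + 2 * (k * 4 ^ k) * (2 * M + k * 4 ^ k)) => m.
have [S S_card S_sampler] := sampler_family k m.
exists (host k M S (2 ^ (m * k) * k * 4 ^ k)); split; first exact: card_edges_host.
by move=> H leH [o [o_adj o_inj o_cover]]; apply: (embeds_host k_gt1 leH o_adj o_inj o_cover).
Qed.

From mathcomp Require Import all_classical all_reals all_analysis.

Local Open Scope ring_scope.

Lemma up_log_size (k n : nat) : (0 < n)%N ->
  exists m : nat, (n <= 2 ^ (m * k.+1) <= 2 ^ k.+1 * n)%N.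
Proof.
move=> n_gt0; exists (up_log (2 ^ k.+1) n).
have P1 : (1 < 2 ^ k.+1)%N by rewrite -{1}(expn0 2) ltn_exp2l.
rewrite mulnC expnM up_logP //=.
have [n1|n1] := leqP n 1.
  by rewrite (_ : n = 1)%N ?up_log1 ?expn0 ?muln1 ?expn_gt0 //; apply/eqP; rewrite eqn_leq n1.
have /andP[/ltnW le _] := up_log_bounds P1 n1.
rewrite -(leq_pmul2l (_ : 0 < 2 ^ k.+1)%N) ?expn_gt0 // in le.
by move: le; rewrite -expnS prednK // up_log_gt0 P1.
Qed.

Theorem theorem1p3 (R : realType) (d : rat) (hd : 1 < d) :
  exists C : R, forall n : nat, exists G : sgraph,
    #|edges G|%:R <= C * (n%:R `^ (2 - 1 / (Num.ceil d + 1)%:~R)) /\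
    universal (density_family d n) G.
Proof.
have [k dk] : exists k : nat, Num.ceil d = k%:Z.
  have : 0 <= Num.ceil d by rewrite ceil_ge0; apply: lt_trans hd.
  by case: (Num.ceil d) => // k _; exists k.
have led : d <= k%:R by have := ceil_ge d; rewrite dk.
have k_gt1 : (1 < k)%N.
  by have := lt_le_trans hd led; rewrite -[1]/(1%:R) ltr_nat.
have [c cP] := oriented_universal k_gt1.
set e : R := 2 - 1 / _.
have eE : e = (2 * k + 1)%N%:R / k.+1%:R.
  rewrite /e dk -[(_ + 1)%R]/(Posz (k + 1)) addn1 -pmulrn.
  have k0 : k.+1%:R != 0 :> R by rewrite pnatr_eq0.
  apply: (mulIf k0); rewrite mulrBl divfK // divfK // -natr1 [in RHS]natrD [in RHS]natrM; ring.
have e_gt0 : 0 < e by rewrite eE divr_gt0 // ltr0n; lia.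
exists (c%:R * (2 ^ k.+1)%N%:R `^ e) => n.
have [->|n_gt0] := posnP n.
  pose G0 := @SGraph unit (fun _ _ => false) (fun _ _ => erefl) (fun _ => erefl).
  exists G0; split.
    rewrite powR0 ?gt_eqF // mulr0 (_ : edges G0 = finset.set0) ?cards0 //.
    by apply/setP => A; rewrite finset.in_set0; apply/imsetP => -[p]; rewrite inE.
  move=> H [H0 _]; have H0' := card0_eq H0.
  by exists (fun=> tt) => x; have := H0' x; rewrite inE.
have [m /andP[le_n le_m]] := up_log_size k n_gt0.
have [G [leG GP]] := cP m; exists G; split; last first.
  move=> H [Hn Hd]; apply: GP; first by rewrite Hn.
  by apply: orientation; apply: le_trans Hd led.
apply: (@le_trans _ _ (c%:R * (2 ^ (m * (2 * k + 1)))%N%:R)).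
  by rewrite -natrM ler_nat.
rewrite -mulrA ler_wpM2l // -powRM // -natrM.
apply: (@le_trans _ _ ((2 ^ (m * k.+1))%N%:R `^ e)).
  rewrite (_ : (2 ^ (m * k.+1))%N%:R = (2 ^ m)%N%:R `^ k.+1%:R); last first.
    by rewrite powR_mulrn // -natrX expnM.
  rewrite -powRrM eE mulrC divfK ?pnatr_eq0 // powR_mulrn // -natrX expnM.
  exact: lexx.
by apply: ge0_ler_powR; rewrite ?nnegrE ?ler0n ?(ltW e_gt0) // ler_nat.
Qed.
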